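(* Let $\mathcal A$ and $\mathcal B$ be non-degenerate, idempotent $^*$-algebras over $\mathsf C$. If $\mathcal A$ and $\mathcal B$ are formally Morita equivalent, then they are also Morita $^*$-equivalent.
   Context: $\mathsf R$ is an ordered ring: an associative commutative ring with $1\neq 0$ and a subset $\mathsf P$ such that $\mathsf R$ is the disjoint union $-\mathsf P\cup\{0\}\cup\mathsf P$ and $\mathsf P+\mathsf P,\ \mathsf P\cdot\mathsf P\subseteq\mathsf P$ (write $a>b$ if $a-b\in\mathsf P$). $\mathsf C=\mathsf R(\mathrm i)$ with $\mathrm i^2=-1$, with the usual conjugation $z\mapsto\overline z$. A $^*$-algebra over $\mathsf C$ is an associative (not necessarily unital) $\mathsf C$-algebra with an antilinear involutive anti-automorphism $^*$. A pre-Hilbert space over $\mathsf C$ is a $\mathsf C$-module $\mathfrak H$ with a positive-definite Hermitian product $\langle\cdot,\cdot\rangle$ with values in $\mathsf C$, linear in the second argument; $\mathfrak B(\mathfrak H)$ is the $^*$-algebra of all $A\in\mathrm{End}_{\mathsf C}(\mathfrak H)$ having an adjoint. A $^*$-representation of $\mathcal A$ is a $^*$-homomorphism $\pi:\mathcal A\to\mathfrak B(\mathfrak H)$. A linear functional $\omega:\mathcal A\to\mathsf C$ is positive if $\omega(A^*A)\ge 0$ for all $A\in\mathcal A$; $\mathcal A^+$ is the set of Hermitian $A\in\mathcal A$ with $\omega(A)\ge0$ for all positive $\omega$. All modules over $^*$-algebras carry a compatible $\mathsf C$-module structure. $\mathcal A$ is non-degenerate if $A\mathcal A=0$ or $\mathcal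 AA=0$ implies $A=0$; it is idempotent if the products $A_1A_2$ span $\mathcal A$. Inner products. For a right $\mathcal A$-module $\mathfrak X$, an $\mathcal A$-valued inner product is a map $\langle\cdot,\cdot\rangle_{\mathcal A}:\mathfrak X\times\mathfrak X\to\mathcal A$ that is $\mathsf C$-linear and right $\mathcal A$-linear in the second argument with $\langle x,y\rangle_{\mathcal A}=\langle y,x\rangle_{\mathcal A}^*$. It is positive semi-definite if $\langle x,x\rangle_{\mathcal A}\in\mathcal A^+$ for all $x$, and full if the $\mathsf C$-span of all $\langle x,y\rangle_{\mathcal A}$ is $\mathcal A$. For a left $\mathcal B$-module, ${}_{\mathcal B}\langle\cdot,\cdot\rangle$ is defined analogously with ($\mathsf C$- and left $\mathcal B$-) linearity in the first argument. Equivalence bimodule. A $(\mathcal B$-$\mathcal A)$-equivalence bimodule is a $(\mathcal B$-$\mathcal A)$-bimodule $\mathfrak X$ with full positive semi-definite inner products $\langle\cdot,\cdot\rangle_{\mathcal A}$ and ${}_{\mathcal B}\langle\cdot,\cdot\rangle$ such that: $\langle B\cdot x,y\rangle_{\mathcal A}=\langle x,B^*\cdot y\rangle_{\mathcal A}$ and ${}_{\mathcal B}\langle x\cdot A,y\rangle={}_{\mathcal B}\langle x,y\cdot A^*\rangle$ (compatible actions); $x\cdot\langle y,z\rangle_{\mathcal A}={}_{\mathcal B}\langle x,y\rangle\cdot z$ for all $x,y,z$ (compatible inner products); property P: for every $^*$-representation $(\pi,\mathfrak H)$ of $\mathcal A$ the Hermitian product on $\mathfrak X\otimes_{\mathcal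 A}\mathfrak H$ determined by $\langle x\otimes\psi,y\otimes\phi\rangle=\langle\psi,\pi(\langle x,y\rangle_{\mathcal A})\phi\rangle_{\mathfrak H}$ is positive semi-definite; property Q: the conjugate $(\mathcal A$-$\mathcal B)$-bimodule $\overline{\mathfrak X}$ (same additive group, elements written $\overline x$, with $z\overline x=\overline{\overline z x}$, $A\cdot\overline x=\overline{x\cdot A^*}$, $\overline x\cdot B=\overline{B^*\cdot x}$ and $\langle\overline x,\overline y\rangle_{\mathcal B}={}_{\mathcal B}\langle x,y\rangle$) has property P with respect to $\mathcal B$. $\mathcal A$ and $\mathcal B$ are formally Morita equivalent if such a bimodule exists. Morita $^*$-equivalence. Non-degenerate idempotent $^*$-algebras $R$ and $S$ are Morita $^*$-equivalent if there is a right $R$-module $\mathcal E$ with $\mathcal E\cdot R=\mathcal E$ (i.e. $\mathcal E$ is spanned by the elements $x\cdot r$), such that $x\cdot R=0$ implies $x=0$, equipped with a full $R$-valued inner product $\langle\cdot,\cdot\rangle$ (no positivity required) such that $\langle x,\mathcal E\rangle=0$ implies $x=0$, and with $S\cong\mathfrak F(\mathcal E_R)$ as $^*$-algebras, where $\mathfrak F(\mathcal E_R)$ is the linear span of the operators $\Theta_{x,y}:z\mapsto x\cdot\langle y,z\rangle$, $x,y\in\mathcal E$, with involution determined by $\Theta_{x,y}^*=\Theta_{y,x}$. *)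

(* Defs.v *)
From HB Require Import structures.
From mathcomp Require Import all_boot all_order all_algebra.
From mathcomp Require Import boolp classical_sets functions complex.

Set Implicit Arguments.
Unset Strict Implicit.
Unset Printing Implicit Defensive.

Import Order.TTheory GRing.Theory Num.Theory.
Local Open Scope classical_set_scope.
Local Open Scope ring_scope.
Local Open Scope quotient_scope.

(* An ordered ring is a totally ordered commutative ring with 1 != 0; it has  *)
(* no zero divisors, so it is a realDomainType.  The library makes R[i] a     *)
(* ring only when R is a field, hence this alias of R[i] for ordered rings.   *)
Definition cplx (R : realDomainType) : Type := complex R.

Section Complex.
Variable R : realDomainType.

HB.instance Definition _ := GRing.Zmodule.copy (cplx R) (complex R).

Fact cplx_mul1 : left_id (Complex 1 0 : cplx R) (@ComplexField.mulc R).
Proof. by case=> a b /=; rewrite !mul1r !mul0r subr0 addr0. Qed.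

Fact cplx_mulDl :
  left_distributive (@ComplexField.mulc R) (+%R : cplx R -> cplx R -> cplx R).
Proof.
case=> a b [c d] [e f]; rewrite /GRing.add /=.
by congr Complex; rewrite !mulrDl ?opprD -!addrA; congr (_ + _); rewrite addrCA.
Qed.

Fact cplx_1neq0 : (Complex 1 0 : cplx R) != 0.
Proof. by rewrite eq_complex /= oner_eq0. Qed.

HB.instance Definition _ := GRing.Zmodule_isComNzRing.Build (cplx R)
  (@ComplexField.mulcA R) (@ComplexField.mulcC R) cplx_mul1 cplx_mulDl
  cplx_1neq0.

Definition conj (z : cplx R) : cplx R := conjc z.

Definition cge0 (z : cplx R) : Prop := complex.Im z = 0 /\ 0 <= complex.Re z.
Definition cgt0 (z : cplx R) : Prop := complex.Im z = 0 /\ 0 < complex.Re z.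

Lemma conjK : involutive conj.
Proof. by case=> a b; rewrite /conj /= opprK. Qed.
Lemma conjD : {morph conj : x y / x + y}.
Proof. by case=> a b [c d]; rewrite /conj /GRing.add /= opprD. Qed.
Lemma conjM : {morph conj : x y / x * y}.
Proof.
case=> a b [c d]; rewrite /conj /GRing.mul /=.
by rewrite mulrNN mulrN mulNr opprD.
Qed.
Lemma conj1 : conj 1 = 1.
Proof. by rewrite /conj /GRing.one /= oppr0. Qed.
End Complex.

Definition lspan (K : pzRingType) (V : lmodType K) (S : set V) : set V :=
  [set v | exists n (c : 'I_n -> K) (s : 'I_n -> V),
     (forall i, S (s i)) /\ v = \sum_i c i *: s i].

Section Span.
Variables (K : pzRingType) (V : lmodType K) (S : set V).

Lemma lspan0 : lspan S 0.
Proof.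
by exists 0%N, (fun=> 0), (fun=> 0); split; [case | rewrite big_ord0].
Qed.

Lemma lspan_gen v : S v -> lspan S v.
Proof.
move=> Sv; exists 1%N, (fun=> 1), (fun=> v); split=> //.
by rewrite big_ord1 scale1r.
Qed.

Lemma lspanP a u v : lspan S u -> lspan S v -> lspan S (a *: u + v).
Proof.
move=> [n [c [s [Ss ->]]]] [m [d [t [St ->]]]].
exists (n + m)%N,
  (fun i => match fintype.split i with inl i => a * c i | inr j => d j end),
  (fun i => match fintype.split i with inl i => s i | inr j => t j end).
split; first by move=> i; case: (fintype.split i).
rewrite big_split_ord scaler_sumr /=; congr (_ + _); apply: eq_bigr => i _.
  by rewrite (unsplitK (inl i)) scalerA.
by rewrite (unsplitK (inr i)).
Qed.

Lemma lspan_ind (P : V -> Prop) : P 0 ->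
  (forall a u v, S u -> P v -> P (a *: u + v)) ->
  forall v, lspan S v -> P v.
Proof.
move=> P0 PS v [n [c [s [Ss ->]]]].
by elim/big_rec: _ => // i x _ Px; apply: PS.
Qed.
End Span.

(* Associative, not necessarily unital. *)
HB.mixin Record isStarAlgebra (R : realDomainType) A
    of GRing.Lmodule (cplx R) A := {
  amul : A -> A -> A;
  star : A -> A;
  amulA : associative amul;
  amulPl : forall (z : cplx R) a b c,
    amul (z *: a + b) c = z *: amul a c + amul b c;
  amulPr : forall (z : cplx R) a b c,
    amul a (z *: b + c) = z *: amul a b + amul a c;
  starP : forall (z : cplx R) a b, star (z *: a + b) = conj z *: star a + star b;
  starM : forall a b, star (amul a b) = amul (star b) (star a);
  starK : involutive star
}.
#[short(type="starAlgType")]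
HB.structure Definition StarAlgebra (R : realDomainType) :=
  {A of GRing.Lmodule (cplx R) A & isStarAlgebra R A}.

Declare Scope star_scope.
Delimit Scope star_scope with star.
Local Open Scope star_scope.
Notation "a ** b" := (amul a b) (at level 40, left associativity) : star_scope.

HB.mixin Record isRightModule (R : realDomainType) (A : starAlgType R) X
    of GRing.Lmodule (cplx R) X := {
  ract : X -> A -> X;
  ractA : forall x a b, ract (ract x a) b = ract x (a ** b);
  ractPl : forall (z : cplx R) x y a,
    ract (z *: x + y) a = z *: ract x a + ract y a;
  ractPr : forall (z : cplx R) x a b,
    ract x (z *: a + b) = z *: ract x a + ract x b
}.
#[short(type="rightModType")]
HB.structure Definition RightModule (R : realDomainType) (A : starAlgType R) :=
  {X of GRing.Lmodule (cplx R) X & isRightModule R A X}.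
Notation "x <* a" := (ract x a) (at level 40, left associativity) : star_scope.

HB.mixin Record isLeftModule (R : realDomainType) (B : starAlgType R) X
    of GRing.Lmodule (cplx R) X := {
  lact : B -> X -> X;
  lactA : forall a b x, lact a (lact b x) = lact (a ** b) x;
  lactPl : forall (z : cplx R) a b x,
    lact (z *: a + b) x = z *: lact a x + lact b x;
  lactPr : forall (z : cplx R) a x y,
    lact a (z *: x + y) = z *: lact a x + lact a y
}.
#[short(type="leftModType")]
HB.structure Definition LeftModule (R : realDomainType) (B : starAlgType R) :=
  {X of GRing.Lmodule (cplx R) X & isLeftModule R B X}.
Notation "b *> x" := (lact b x) (at level 40, left associativity) : star_scope.

HB.mixin Record isBimodule (R : realDomainType) (B A : starAlgType R) X
    of LeftModule R B X & RightModule R A X := {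
  lractA : forall (b : B) (x : X) (a : A), (b *> x) <* a = b *> (x <* a)
}.
#[short(type="bimodType")]
HB.structure Definition Bimodule (R : realDomainType) (B A : starAlgType R) :=
  {X of LeftModule R B X & RightModule R A X & isBimodule R B A X}.

Section ConjugateModule.
Variable R : realDomainType.
Local Notation C := (cplx R).

Definition conjmod (X : Type) : Type := X.

Section Lmodule.
Variable X : lmodType C.
HB.instance Definition _ := GRing.Zmodule.on (conjmod X).
Definition conj_scale (z : C) (x : conjmod X) : conjmod X := conj z *: (x : X).

Fact conj_scalerA a b v :
  conj_scale a (conj_scale b v) = conj_scale (a * b) v.
Proof. by rewrite /conj_scale scalerA conjM. Qed.
Fact conj_scale1r : left_id 1 conj_scale.
Proof. by move=> x; rewrite /conj_scale conj1 scale1r. Qed.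
Fact conj_scalerDr : right_distributive conj_scale +%R.
Proof. by move=> z x y; rewrite /conj_scale scalerDr. Qed.
Fact conj_scalerDl v : {morph conj_scale^~ v : a b / a + b}.
Proof. by move=> a b; rewrite /conj_scale conjD scalerDl. Qed.
HB.instance Definition _ := GRing.Zmodule_isLmodule.Build C (conjmod X)
  conj_scalerA conj_scale1r conj_scalerDr conj_scalerDl.
End Lmodule.

Section Left.
Variables (B : starAlgType R) (X : leftModType B).
Definition conj_ract (x : conjmod X) (b : B) : conjmod X := star b *> (x : X).
Fact conj_ractA x a b : conj_ract (conj_ract x a) b = conj_ract x (a ** b).
Proof. by rewrite /conj_ract lactA starM. Qed.
Fact conj_ractPl (z : C) x y a :
  conj_ract (z *: x + y) a = z *: conj_ract x a + conj_ract y a.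
Proof. exact: lactPr. Qed.
Fact conj_ractPr (z : C) x a b :
  conj_ract x (z *: a + b) = z *: conj_ract x a + conj_ract x b.
Proof. by rewrite /conj_ract starP lactPl. Qed.
HB.instance Definition _ := isRightModule.Build R B (conjmod X)
  conj_ractA conj_ractPl conj_ractPr.
End Left.

Section Right.
Variables (A : starAlgType R) (X : rightModType A).
Definition conj_lact (a : A) (x : conjmod X) : conjmod X := (x : X) <* star a.
Fact conj_lactA a b x : conj_lact a (conj_lact b x) = conj_lact (a ** b) x.
Proof. by rewrite /conj_lact ractA starM. Qed.
Fact conj_lactPl (z : C) a b x :
  conj_lact (z *: a + b) x = z *: conj_lact a x + conj_lact b x.
Proof. by rewrite /conj_lact starP ractPr. Qed.
Fact conj_lactPr (z : C) a x y :
  conj_lact a (z *: x + y) = z *: conj_lact a x + conj_lact a y.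
Proof. exact: ractPl. Qed.
HB.instance Definition _ := isLeftModule.Build R A (conjmod X)
  conj_lactA conj_lactPl conj_lactPr.
End Right.

Fact conj_lractA (B A : starAlgType R) (X : bimodType B A) (a : A)
  (x : conjmod X) (b : B) : (a *> x) <* b = a *> (x <* b).
Proof. by symmetry; exact: lractA. Qed.
HB.instance Definition _ (B A : starAlgType R) (X : bimodType B A) :=
  isBimodule.Build R A B (conjmod X) (@conj_lractA B A X).
End ConjugateModule.

Section Zero.
Variables (R : realDomainType) (A : starAlgType R).

Lemma addrr_eq0 (V : zmodType) (x : V) : x = x + x -> x = 0.
Proof. by move=> h; apply: (addrI x); rewrite addr0 -h. Qed.

Lemma star0 : star (0 : A) = 0.
Proof.
by apply: addrr_eq0; have := starP 1 (0 : A) 0; rewrite conj1 !scale1r addr0.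
Qed.

Lemma ract0l (X : rightModType A) (a : A) : (0 : X) <* a = 0.
Proof.
by apply: addrr_eq0; have := ractPl 1 (0 : X) 0 a; rewrite !scale1r addr0.
Qed.
End Zero.

(* X (x)_A M as formal sums of elementary tensors modulo the congruence       *)
(* generated by biadditivity and by C- and A-balancedness; [tens_0l] gives    *)
(* additive inverses, the formal sums themselves being only a monoid.         *)
Section Tensor.
Variables (R : realDomainType) (A : starAlgType R).
Variables (X : rightModType A) (M : leftModType A).
Local Notation C := (cplx R).
Local Notation fsum := (seq (X * M)).

Inductive tens_eq : fsum -> fsum -> Prop :=
| tens_refl s : tens_eq s s
| tens_sym s t : tens_eq s t -> tens_eq t s
| tens_trans t s u : tens_eq s t -> tens_eq t u -> tens_eq s u
| tens_cat s s' t t' :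
    tens_eq s s' -> tens_eq t t' -> tens_eq (s ++ t) (s' ++ t')
| tens_catC s t : tens_eq (s ++ t) (t ++ s)
| tens_0l m : tens_eq [:: (0, m)] [::]
| tens_Dl x y m : tens_eq [:: (x + y, m)] [:: (x, m); (y, m)]
| tens_Dr x m n : tens_eq [:: (x, m + n)] [:: (x, m); (x, n)]
| tens_Z (z : C) x m : tens_eq [:: (z *: x, m)] [:: (x, z *: m)]
| tens_act a x m : tens_eq [:: (x <* a, m)] [:: (x, a *> m)].

Definition tens_eqb : rel fsum := fun s t => `[< tens_eq s t >].

Fact tens_equiv : equiv_class_of tens_eqb.
Proof.
split=> [s|s t|t s u]; first by apply/asboolP; exact: tens_refl.
- by apply/asboolP/asboolP; exact: tens_sym.
- by move=> /asboolP st /asboolP tu; apply/asboolP; apply: tens_trans st tu.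
Qed.
Canonical tens_equiv_rel := EquivRelPack tens_equiv.

Definition tensor : Type := {eq_quot tens_eqb}.
HB.instance Definition _ := Choice.on tensor.

Definition tens_of (s : fsum) : tensor := \pi_({eq_quot tens_eqb}) s.
Definition tens_rep (t : tensor) : fsum := repr (t : {eq_quot tens_eqb}).
Definition tens (x : X) (m : M) : tensor := tens_of [:: (x, m)].

Lemma tens_ofP s t : tens_of s = tens_of t <-> tens_eq s t.
Proof.
have E := @eqmodP _ tens_equiv_rel s t.
by split=> [/E /asboolP|st]; [|apply/E/asboolP].
Qed.
Lemma tens_repK t : tens_of (tens_rep t) = t.
Proof. exact: (reprK (t : {eq_quot tens_eqb})). Qed.
Lemma tens_repP s : tens_eq (tens_rep (tens_of s)) s.
Proof. by apply/tens_ofP; rewrite tens_repK. Qed.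

Definition tens_add (t u : tensor) : tensor := tens_of (tens_rep t ++ tens_rep u).

Lemma tens_addE s t : tens_add (tens_of s) (tens_of t) = tens_of (s ++ t).
Proof. by apply/tens_ofP/tens_cat; exact: tens_repP. Qed.

Fact tens_addA : associative tens_add.
Proof.
move=> t u v; rewrite -(tens_repK t) -(tens_repK u) -(tens_repK v).
by rewrite !tens_addE catA.
Qed.
Fact tens_addC : commutative tens_add.
Proof. by move=> t u; apply/tens_ofP/tens_catC. Qed.
Fact tens_add0 : left_id (tens_of [::]) tens_add.
Proof. by move=> t; rewrite -(tens_repK t) tens_addE. Qed.
HB.instance Definition _ :=
  GRing.isNmodule.Build tensor tens_addA tens_addC tens_add0.

Lemma tens_of_cat s t : tens_of (s ++ t) = tens_of s + tens_of t.
Proof. by rewrite [RHS]tens_addE. Qed.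
Lemma tens_of_cons p s : tens_of (p :: s) = tens p.1 p.2 + tens_of s.
Proof. by rewrite -cat1s tens_of_cat; case: p. Qed.
Lemma tens_of_nil : tens_of [::] = 0.
Proof. by []. Qed.
Lemma tens0l m : tens 0 m = 0.
Proof. exact/tens_ofP/tens_0l. Qed.
Lemma tensDl x y m : tens (x + y) m = tens x m + tens y m.
Proof. by rewrite -[RHS]tens_of_cat; apply/tens_ofP/tens_Dl. Qed.
Lemma tensDr x m n : tens x (m + n) = tens x m + tens x n.
Proof. by rewrite -[RHS]tens_of_cat; apply/tens_ofP/tens_Dr. Qed.

Definition tens_scale_rep (z : C) (s : fsum) : fsum :=
  [seq (z *: p.1, p.2) | p <- s].

Lemma tens_scale_repP z s t :
  tens_eq s t -> tens_eq (tens_scale_rep z s) (tens_scale_rep z t).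
Proof.
elim=> {s t} /=.
- by move=> s; exact: tens_refl.
- by move=> s t _; exact: tens_sym.
- by move=> t s u _ st _; exact: tens_trans.
- by move=> s s' t t' _ ss _ tt; rewrite /tens_scale_rep !map_cat; exact: tens_cat.
- by move=> s t; rewrite /tens_scale_rep !map_cat; exact: tens_catC.
- by move=> m; rewrite scaler0; exact: tens_0l.
- by move=> x y m; rewrite scalerDr; exact: tens_Dl.
- by move=> x m n; exact: tens_Dr.
- by move=> c x m; rewrite scalerA mulrC -scalerA; exact: tens_Z.
- move=> a x m; have -> : z *: (x <* a) = (z *: x) <* a.
    by have := ractPl z x 0 a; rewrite ract0l !addr0.
  exact: tens_act.
Qed.

Definition tens_scale (z : C) (t : tensor) : tensor :=
  tens_of (tens_scale_rep z (tens_rep t)).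

Lemma tens_scaleE z s : tens_scale z (tens_of s) = tens_of (tens_scale_rep z s).
Proof. by apply/tens_ofP/tens_scale_repP/tens_repP. Qed.

Fact tens_addN : left_inverse 0 (tens_scale (- 1)) +%R.
Proof.
move=> t; rewrite -(tens_repK t) tens_scaleE.
elim: (tens_rep t) => [|[x m] s IHs]; first exact: addr0.
by rewrite /= !tens_of_cons /= addrACA IHs -tensDl scaleN1r addNr tens0l addr0.
Qed.
HB.instance Definition _ := GRing.Nmodule_isZmodule.Build tensor tens_addN.

Fact tens_scaleA a b t :
  tens_scale a (tens_scale b t) = tens_scale (a * b) t.
Proof.
rewrite -(tens_repK t) !tens_scaleE; congr tens_of.
by rewrite /tens_scale_rep -map_comp; apply: eq_map => -[x m] /=; rewrite scalerA.
Qed.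
Fact tens_scale1 : left_id 1 tens_scale.
Proof.
move=> t; rewrite -(tens_repK t) tens_scaleE; congr tens_of.
by rewrite -[RHS]map_id; apply: eq_map => -[x m] /=; rewrite scale1r.
Qed.
Fact tens_scaleDr : right_distributive tens_scale +%R.
Proof.
move=> z t u; rewrite -(tens_repK t) -(tens_repK u) -tens_of_cat !tens_scaleE.
by rewrite /tens_scale_rep map_cat tens_of_cat.
Qed.
Fact tens_scaleDl t : {morph tens_scale^~ t : a b / a + b}.
Proof.
move=> a b; rewrite -(tens_repK t) !tens_scaleE.
elim: (tens_rep t) => [|[x m] s IHs]; first by rewrite addr0.
by rewrite /= !tens_of_cons /= addrACA IHs scalerDl tensDl.
Qed.
HB.instance Definition _ := GRing.Zmodule_isLmodule.Build C tensor
  tens_scaleA tens_scale1 tens_scaleDr tens_scaleDl.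

Lemma tensZl z x m : tens (z *: x) m = z *: tens x m.
Proof. by rewrite [RHS]tens_scaleE. Qed.
Lemma tensZr z x m : tens x (z *: m) = z *: tens x m.
Proof. by rewrite -tensZl; symmetry; apply/tens_ofP/tens_Z. Qed.
Lemma tens_balanced x a m : tens (x <* a) m = tens x (a *> m).
Proof. exact/tens_ofP/tens_act. Qed.
Lemma tensor_sum t : exists s : fsum, t = \sum_(p <- s) tens p.1 p.2.
Proof.
exists (tens_rep t); rewrite -[LHS]tens_repK.
elim: (tens_rep t) => [|p s IHs]; first by rewrite big_nil.
by rewrite tens_of_cons big_cons IHs.
Qed.
End Tensor.

Section Hermitian.
Variable R : realDomainType.
Local Notation C := (cplx R).

Definition hermitian_product (V : lmodType C) (h : V -> V -> C) : Prop :=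
  (forall (z : C) x y y', h x (z *: y + y') = z * h x y + h x y') /\
  (forall x y, h x y = conj (h y x)).

Definition positive_semidefinite (V : lmodType C) (h : V -> V -> C) : Prop :=
  forall x, cge0 (h x x).

Definition positive_definite (V : lmodType C) (h : V -> V -> C) : Prop :=
  forall x, x != 0 -> cgt0 (h x x).

Record preHilbert : Type := PreHilbert {
  ph_sort :> lmodType C;
  ph_prod : ph_sort -> ph_sort -> C;
  ph_hermitian : hermitian_product ph_prod;
  ph_posdef : positive_definite ph_prod
}.

(* A *-homomorphism from A to B(H): [rep_adj] says that every rep a has an    *)
(* adjoint, namely rep (star a); adjoints are unique as H is pre-Hilbert.     *)
Record starRep (A : starAlgType R) (H : preHilbert) : Type := StarRep {
  rep :> A -> {linear H -> H};
  repP : forall (z : C) a b psi,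
    rep (z *: a + b) psi = z *: rep a psi + rep b psi;
  repM : forall a b psi, rep (a ** b) psi = rep a (rep b psi);
  rep_adj : forall a psi phi,
    ph_prod (rep a psi) phi = ph_prod psi (rep (star a) phi)
}.

Section RepModule.
Variables (A : starAlgType R) (H : preHilbert) (pi : starRep A H).
Definition rep_module of starRep A H : Type := H.
HB.instance Definition _ := GRing.Lmodule.on (rep_module pi).
Definition rep_lact (a : A) (psi : rep_module pi) : rep_module pi := pi a psi.
Fact rep_lactA a b x : rep_lact a (rep_lact b x) = rep_lact (a ** b) x.
Proof. by rewrite /rep_lact repM. Qed.
Fact rep_lactPl (z : C) a b x :
  rep_lact (z *: a + b) x = z *: rep_lact a x + rep_lact b x.
Proof. exact: repP. Qed.
Fact rep_lactPr (z : C) a x y :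
  rep_lact a (z *: x + y) = z *: rep_lact a x + rep_lact a y.
Proof. exact: linearP. Qed.
HB.instance Definition _ := isLeftModule.Build R A (rep_module pi)
  rep_lactA rep_lactPl rep_lactPr.
End RepModule.

Definition positive_functional (A : starAlgType R) (w : {scalar A}) : Prop :=
  forall a, cge0 (w (star a ** a)).

Definition positive_element (A : starAlgType R) (a : A) : Prop :=
  star a = a /\ forall w : {scalar A}, positive_functional w -> cge0 (w a).

Definition nondegenerate_alg (A : starAlgType R) : Prop :=
  (forall a : A, (forall b, a ** b = 0) -> a = 0) /\
  (forall a : A, (forall b, b ** a = 0) -> a = 0).

Definition idempotent_alg (A : starAlgType R) : Prop :=
  lspan [set c : A | exists a b, c = a ** b] = setT.

Definition star_isomorphism (A B : starAlgType R) (f : A -> B) : Prop :=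
  [/\ forall (z : C) a b, f (z *: a + b) = z *: f a + f b,
      forall a b, f (a ** b) = f a ** f b,
      forall a, f (star a) = star (f a) &
      bijective f].

Definition star_isomorphic (A B : starAlgType R) : Prop :=
  exists f : A -> B, star_isomorphism f.
End Hermitian.

Section InnerProducts.
Variable R : realDomainType.
Local Notation C := (cplx R).

Definition right_inner_product (A : starAlgType R) (X : rightModType A)
    (ip : X -> X -> A) : Prop :=
  [/\ forall (z : C) x y y', ip x (z *: y + y') = z *: ip x y + ip x y',
      forall x y a, ip x (y <* a) = ip x y ** a &
      forall x y, ip x y = star (ip y x)].

Definition left_inner_product (B : starAlgType R) (X : leftModType B)
    (ip : X -> X -> B) : Prop :=
  [/\ forall (z : C) x x' y, ip (z *: x + x') y = z *: ip x y + ip x' y,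
      forall b x y, ip (b *> x) y = b ** ip x y &
      forall x y, ip x y = star (ip y x)].

Definition positive_ip (A : starAlgType R) (X : Type) (ip : X -> X -> A) :=
  forall x, positive_element (ip x x).

Definition full_ip (A : starAlgType R) (X : Type) (ip : X -> X -> A) :=
  lspan [set a | exists x y, a = ip x y] = setT.

Definition nondegenerate_ip (A : starAlgType R) (X : lmodType C)
    (ip : X -> X -> A) : Prop :=
  forall x, (forall y, ip x y = 0) -> x = 0.

(* The form h is unique, as elementary tensors generate the tensor product    *)
(* (tensor_sum), and always exists when ip is a right inner product; the      *)
(* requirement is its positivity.                                             *)
Definition property_P (A : starAlgType R) (X : rightModType A)
    (ip : X -> X -> A) : Prop :=
  forall (H : preHilbert R) (pi : starRep A H),
  exists h : tensor X (rep_module pi) -> tensor X (rep_module pi) -> C,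
    [/\ hermitian_product h,
        forall x y (psi phi : H),
          h (@tens R A X (rep_module pi) x psi)
            (@tens R A X (rep_module pi) y phi)
          = ph_prod psi (pi (ip x y) phi) &
        positive_semidefinite h].

Definition conj_ip (B : starAlgType R) (X : leftModType B)
  (ip : X -> X -> B) : conjmod X -> conjmod X -> B := ip.

Definition property_Q (B : starAlgType R) (X : leftModType B)
    (ip : X -> X -> B) : Prop :=
  @property_P B (conjmod X) (@conj_ip B X ip).

Record equivalence_bimodule (B A : starAlgType R) (X : bimodType B A)
    (ipA : X -> X -> A) (ipB : X -> X -> B) : Prop := EquivalenceBimodule {
  eb_ipA : right_inner_product ipA;
  eb_ipB : left_inner_product ipB;
  eb_fullA : full_ip ipA;
  eb_fullB : full_ip ipB;
  eb_posA : positive_ip ipA;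
  eb_posB : positive_ip ipB;
  eb_actB : forall (b : B) x y, ipA (b *> x) y = ipA x (star b *> y);
  eb_actA : forall (a : A) x y, ipB (x <* a) y = ipB x (y <* star a);
  eb_compat : forall x y z, x <* ipA y z = ipB x y *> z;
  eb_P : property_P ipA;
  eb_Q : property_Q ipB
}.

Definition formally_morita_equivalent (A B : starAlgType R) : Prop :=
  exists (X : bimodType B A) (ipA : X -> X -> A) (ipB : X -> X -> B),
    equivalence_bimodule ipA ipB.

Definition Theta (A : starAlgType R) (X : rightModType A) (ip : X -> X -> A)
  (x y : X) : X -> X := fun z => x <* ip y z.
End InnerProducts.

Record nd_inner_product (R : realDomainType) (A : starAlgType R)
    (E : rightModType A) : Type := NdInnerProduct {
  ndip :> E -> E -> A;
  ndipP : right_inner_product ndip;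
  ndip_nd : nondegenerate_ip ndip
}.

(* The *-algebra F(E_A).  Its involution is introduced as the adjoint with    *)
(* respect to the inner product; [star_Theta] is the formula determining it.  *)
Section FiniteRank.
Variables (R : realDomainType) (A : starAlgType R) (E : rightModType A).
Variable ip : nd_inner_product E.
Local Notation C := (cplx R).

Definition finite_rank_op : set (E -> E) :=
  lspan [set f | exists x y, f = Theta ip x y].

Definition finite_rank_pred : {pred E -> E} :=
  fun f => `[< finite_rank_op f >].

Fact finite_rank_submod : submod_closed finite_rank_pred.
Proof.
split; first by apply/asboolP; exact: lspan0.
by move=> a f g /asboolP Ff /asboolP Fg; apply/asboolP; exact: lspanP.
Qed.
HB.instance Definition _ :=
  GRing.isSubmodClosed.Build C (E -> E) finite_rank_pred finite_rank_submod.

Record finite_rank : Type := FiniteRank {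
  fr_val :> E -> E;
  fr_valP : fr_val \in finite_rank_pred
}.
HB.instance Definition _ := [isSub for fr_val].
HB.instance Definition _ := [Choice of finite_rank by <:].
HB.instance Definition _ := [SubChoice_isSubLmodule of finite_rank by <:].

Let ipPr z x y y' : ip x (z *: y + y') = z *: ip x y + ip x y'.
Proof. by have [h _ _] := ndipP ip; exact: h. Qed.
Let ipA x y a : ip x (y <* a) = ip x y ** a.
Proof. by have [_ h _] := ndipP ip; exact: h. Qed.
Let ipC x y : ip x y = star (ip y x).
Proof. by have [_ _ h] := ndipP ip; exact: h. Qed.
Let funPE (z : C) (f g : E -> E) x : (z *: f + g) x = z *: f x + g x.
Proof. by []. Qed.

Lemma Theta_finite_rank x y : Theta ip x y \in finite_rank_pred.
Proof. by apply/asboolP/lspan_gen; exists x, y. Qed.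

Lemma finite_rankE (f : finite_rank) : finite_rank_op f.
Proof. exact/asboolP/fr_valP. Qed.

Lemma finite_rank_linear (f : finite_rank) (z : C) x y :
  f (z *: x + y) = z *: f x + f y.
Proof.
elim/lspan_ind: (finite_rankE f) => [|c u v [p [q ->]] IH].
  by rewrite /= scaler0 addr0.
rewrite !funPE IH /Theta ipPr ractPr !scalerDr.
by rewrite !scalerA [z * c]mulrC addrACA.
Qed.

Lemma finite_rank_ract (f : finite_rank) x a : f (x <* a) = f x <* a.
Proof.
elim/lspan_ind: (finite_rankE f) => [|c u v [p [q ->]] IH].
  by rewrite ract0l.
by rewrite !funPE IH ractPl /Theta ipA ractA.
Qed.

Fact finite_rank_comp (f g : finite_rank) : f \o g \in finite_rank_pred.
Proof.
apply/asboolP; elim/lspan_ind: (finite_rankE g) => [|c u v [p [q ->]] IH].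
  suff -> : f \o (0 : E -> E) = 0 by exact: lspan0.
  apply/funext => x; apply: addrr_eq0.
  by have := finite_rank_linear f 1 0 0; rewrite !scale1r addr0.
suff -> : f \o (c *: Theta ip p q + v) = c *: Theta ip (f p) q + (f \o v).
  by apply: lspanP => //; apply: lspan_gen; exists (f p), q.
by apply/funext => x; rewrite /= finite_rank_linear /Theta finite_rank_ract.
Qed.
Definition fr_mul (f g : finite_rank) : finite_rank :=
  FiniteRank (finite_rank_comp f g).

Definition adjoint_ops (f g : E -> E) : Prop :=
  forall x y, ip (f x) y = ip x (g y).

Lemma adjoint_Theta x y : adjoint_ops (Theta ip x y) (Theta ip y x).
Proof. by move=> u v; rewrite /Theta ipA ipC ipA starM -!ipC. Qed.

Lemma adjoint_sym f g : adjoint_ops f g -> adjoint_ops g f.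
Proof. by move=> fg x y; rewrite ipC -fg -ipC. Qed.

Lemma adjoint_uniq f g h : adjoint_ops f g -> adjoint_ops f h -> g = h.
Proof.
move=> fg fh; apply/funext => x; apply/eqP; rewrite -subr_eq0; apply/eqP.
apply: (ndip_nd (n := ip)) => y; rewrite ipC -scaleN1r addrC ipPr.
by rewrite -fg -fh scaleN1r addNr star0.
Qed.

Lemma adjoint_lin (z : C) f f' g g' : adjoint_ops f f' -> adjoint_ops g g' ->
  adjoint_ops (z *: f + g) (conj z *: f' + g').
Proof.
move=> ff gg x y; rewrite !funPE ipPr -ff -gg.
by rewrite ipC ipPr starP -!ipC.
Qed.

Fact finite_rank_adjoint (f : finite_rank) :
  exists g : finite_rank, adjoint_ops f g.
Proof.
suff [g [Fg fg]] : exists g, g \in finite_rank_pred /\ adjoint_ops f g.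
  by exists (FiniteRank Fg).
elim/lspan_ind: (finite_rankE f) => [|c u v [p [q ->]] [g [/asboolP Fg vg]]].
  exists 0; split; first by apply/asboolP; exact: lspan0.
  move=> x y; rewrite /= ipC; suff h w : ip w 0 = 0 by rewrite !h star0.
  by apply: addrr_eq0; have := ipPr 1 w 0 0; rewrite !scale1r addr0.
exists (conj c *: Theta ip q p + g); split.
  by apply/asboolP; apply: lspanP => //; apply: lspan_gen; exists q, p.
by apply: adjoint_lin => //; exact: adjoint_Theta.
Qed.
Definition fr_star (f : finite_rank) : finite_rank :=
  sval (cid (finite_rank_adjoint f)).
Lemma fr_starP (f : finite_rank) : adjoint_ops f (fr_star f).
Proof. by rewrite /fr_star; case: cid. Qed.
Lemma fr_star_uniq (f g : finite_rank) : adjoint_ops f g -> fr_star f = g.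
Proof. by move=> fg; apply/val_inj/(adjoint_uniq (fr_starP f) fg). Qed.

Fact fr_mulA : associative fr_mul.
Proof. by move=> f g h; apply/val_inj. Qed.
Fact fr_mulPl (z : C) f g h :
  fr_mul (z *: f + g) h = z *: fr_mul f h + fr_mul g h.
Proof. exact/val_inj. Qed.
Fact fr_mulPr (z : C) f g h :
  fr_mul f (z *: g + h) = z *: fr_mul f g + fr_mul f h.
Proof. by apply/val_inj/funext => x; exact: finite_rank_linear. Qed.
Fact fr_starPlin (z : C) f g :
  fr_star (z *: f + g) = conj z *: fr_star f + fr_star g.
Proof. by apply: fr_star_uniq; apply: adjoint_lin; exact: fr_starP. Qed.
Fact fr_starM f g : fr_star (fr_mul f g) = fr_mul (fr_star g) (fr_star f).
Proof. by apply: fr_star_uniq => x y /=; rewrite !fr_starP. Qed.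
Fact fr_starK : involutive fr_star.
Proof. by move=> f; apply/fr_star_uniq/adjoint_sym/fr_starP. Qed.
HB.instance Definition _ := isStarAlgebra.Build R finite_rank
  fr_mulA fr_mulPl fr_mulPr fr_starPlin fr_starM fr_starK.

Definition fr_Theta x y : finite_rank := FiniteRank (Theta_finite_rank x y).
Lemma star_Theta x y : star (fr_Theta x y) = fr_Theta y x.
Proof. by apply: fr_star_uniq; exact: adjoint_Theta. Qed.
End FiniteRank.

Definition morita_star_equivalent (R : realDomainType) (A B : starAlgType R) :
    Prop :=
  exists (E : rightModType A) (ip : nd_inner_product E),
    [/\ lspan [set y : E | exists x a, y = x <* a] = setT,
        forall x : E, (forall a : A, x <* a = 0) -> x = 0,
        full_ip ip &
        star_isomorphic B (finite_rank ip)].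

(* Main.v *)
(** Passing from [X] to the functions [<., x> : X -> A] divides out the
    degenerate part of the inner product without a quotient: the module [E] of
    the Morita *-equivalence is the span of the functions [<., x a>].  By
    compatibility of the inner products, [b = B<x, y>] acts on [E] as
    [Theta] of the functions given by [x] and [y], so that fullness of
    [B<., .>] identifies [B] with the finite rank operators on [E]. *)

From HB Require Import structures.
Require Import Defs.
From mathcomp Require Import all_boot all_order all_algebra.
From mathcomp Require Import boolp classical_sets functions.

Set Implicit Arguments.
Unset Strict Implicit.
Unset Printing Implicit Defensive.

Import GRing.Theory.
Local Open Scope classical_set_scope.
Local Open Scope ring_scope.
Local Open Scope star_scope.

(** * Spanning sets, zero laws and idempotent algebras *)

Lemma spanning_ind (K : pzRingType) (V : lmodType K) (S P : set V) :
  lspan S = setT -> P 0 -> (forall a u v, P u -> P v -> P (a *: u + v)) ->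
  (forall v, S v -> P v) -> forall v, P v.
Proof.
move=> spanS P0 PD SP v; have : lspan S v by rewrite spanS.
by apply: lspan_ind => // a u w Su; apply: PD; exact: SP.
Qed.

Lemma linear_eq0 (K : pzRingType) (V W : lmodType K) (f : V -> W) :
  (forall a u v, f (a *: u + v) = a *: f u + f v) -> f 0 = 0.
Proof.
by move=> fP; apply: addrr_eq0; have := fP 1 0 0; rewrite !scale1r addr0.
Qed.

Section StarAlgebra.
Variables (R : realDomainType) (A : starAlgType R).

Lemma amul0l (a : A) : 0 ** a = 0.
Proof. by apply: (linear_eq0 (f := amul^~ a)) => z u v; exact: amulPl. Qed.

Lemma amul0r (a : A) : a ** 0 = 0.
Proof. by apply: linear_eq0 => z u v; exact: amulPr. Qed.

Lemma lact0l (X : leftModType A) (x : X) : (0 : A) *> x = 0.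
Proof. by apply: (linear_eq0 (f := lact^~ x)) => z u v; exact: lactPl. Qed.

Lemma ract0r (X : rightModType A) (x : X) : x <* (0 : A) = 0.
Proof. by apply: linear_eq0 => z u v; exact: ractPr. Qed.

(** Idempotence, applied twice, splits elements into triple products, whose middle factor is
    expanded over [S]. When [S] consists of inner product values, the outer factors can be moved
    into the arguments. *)
Lemma idempotent_span3 (S : set A) : idempotent_alg A -> lspan S = setT ->
  lspan [set c | exists a s b, S s /\ c = a ** s ** b] = setT.
Proof.
move=> idem spanS; rewrite -subTset => c _; move: c.
apply: (spanning_ind idem); [exact: lspan0|exact: lspanP|] => _ [a [b ->]].
move: a; apply: (spanning_ind idem).
- by rewrite amul0l; exact: lspan0.
- by move=> z u v ? ?; rewrite amulPl; exact: lspanP.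
move=> _ [a [s ->]]; move: s; apply: (spanning_ind spanS).
- by rewrite amul0r amul0l; exact: lspan0.
- by move=> z u v ? ?; rewrite amulPr amulPl; exact: lspanP.
by move=> s Ss; apply: lspan_gen; exists a, s, b.
Qed.
End StarAlgebra.

(** * The module of kets and its inner product *)

Section RightInnerProduct.
Variables (R : realDomainType) (A : starAlgType R) (X : rightModType A).
Variables (ip : X -> X -> A) (ipP : right_inner_product ip).

Lemma rip_linear (z : cplx R) x y y' :
  ip x (z *: y + y') = z *: ip x y + ip x y'.
Proof. by case: ipP. Qed.

Lemma rip_ract x y a : ip x (y <* a) = ip x y ** a.
Proof. by case: ipP. Qed.

Lemma rip_star x y : ip x y = star (ip y x).
Proof. by case: ipP. Qed.

Lemma rip_ractl x y a : ip (x <* a) y = star a ** ip x y.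
Proof. by rewrite rip_star rip_ract starM -rip_star. Qed.

Lemma rip0 x : ip x 0 = 0.
Proof. by apply: linear_eq0 => z u v; exact: rip_linear. Qed.

Definition ket (x : X) : X -> A := ip^~ x.

Lemma ketP (z : cplx R) x y : ket (z *: x + y) = z *: ket x + ket y.
Proof. by apply/funext => u; rewrite /ket rip_linear. Qed.

(** The factor [a] lets idempotence of [A] give [E A = E]; the span of [X A] may be smaller than
    [X]. *)
Definition kets : set (X -> A) := lspan [set f | exists x a, f = ket (x <* a)].
Definition ket_pred : {pred X -> A} := fun f => `[< kets f >].

Fact ket_submod : submod_closed ket_pred.
Proof.
split; first by apply/asboolP; exact: lspan0.
by move=> a f g /asboolP Ff /asboolP Fg; apply/asboolP; exact: lspanP.
Qed.
HB.instance Definition _ :=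
  GRing.isSubmodClosed.Build (cplx R) (X -> A) ket_pred ket_submod.

Record ket_space : Type := KetSpace {
  ks_val :> X -> A;
  ks_valP : ks_val \in ket_pred
}.
HB.instance Definition _ := [isSub for ks_val].
HB.instance Definition _ := [Choice of ket_space by <:].
HB.instance Definition _ := [SubChoice_isSubLmodule of ket_space by <:].

(* The phantom argument lets unification recover the proof on which the right
   module structure depends. *)
Definition ket_module of right_inner_product ip : Type := ket_space.
Local Notation E := (ket_module ipP).
HB.instance Definition _ := GRing.Lmodule.on E.

Lemma ket_moduleE (f : E) : kets f.
Proof. exact/asboolP/ks_valP. Qed.

(** Linearity of [ket] collapses a combination of generators to one vector, in general not
    unique. *)
Lemma ket_module_ket (f : E) : exists x, f = ket x :> (X -> A).
Proof.
elim/lspan_ind: (ket_moduleE f) => [|z _ v [x [a ->]] [y ->]].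
  by exists 0; apply/funext => u; rewrite /ket rip0.
by exists (z *: (x <* a) + y); rewrite ketP.
Qed.

Fact ket_ract_subproof (f : E) (a : A) : (fun y => f y ** a) \in ket_pred.
Proof.
apply/asboolP; elim/lspan_ind: (ket_moduleE f) => [|z _ v [x [b ->]] IH].
  suff -> : (fun y : X => (0 : X -> A) y ** a) = 0 by exact: lspan0.
  by apply/funext => y; exact: amul0l.
suff -> : (fun y => (z *: ket (x <* b) + v) y ** a)
    = z *: ket (x <* (b ** a)) + (fun y => v y ** a).
  by apply: lspanP => //; apply: lspan_gen; exists x, (b ** a).
by apply/funext => y; rewrite [LHS]amulPl -ractA /ket -rip_ract.
Qed.
Definition ket_ract (f : E) (a : A) : E := KetSpace (ket_ract_subproof f a).

Fact ket_ractA f a b : ket_ract (ket_ract f a) b = ket_ract f (a ** b).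
Proof. by apply/val_inj/funext => y /=; rewrite amulA. Qed.
Fact ket_ractPl (z : cplx R) f g a :
  ket_ract (z *: f + g) a = z *: ket_ract f a + ket_ract g a.
Proof. by apply/val_inj/funext => y; exact: amulPl. Qed.
Fact ket_ractPr (z : cplx R) f a b :
  ket_ract f (z *: a + b) = z *: ket_ract f a + ket_ract f b.
Proof. by apply/val_inj/funext => y; exact: amulPr. Qed.
HB.instance Definition _ := isRightModule.Build R A E
  ket_ractA ket_ractPl ket_ractPr.

Fact ket_of_subproof x a : ket (x <* a) \in ket_pred.
Proof. by apply/asboolP/lspan_gen; exists x, a. Qed.
Definition ket_of x a : E := KetSpace (ket_of_subproof x a).

(** If [f = ket x] and [g = ket y], then [g x] is [ip x y]; [ket_ipE] shows that the choice of [x]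
    is immaterial. *)
Definition ket_ip (f g : E) : A := g (sval (cid (ket_module_ket f))).

Lemma ket_ipE (f g : E) x y :
  f = ket x :> (X -> A) -> g = ket y :> (X -> A) -> ket_ip f g = ip x y.
Proof.
move=> fx gy; rewrite /ket_ip; case: cid => x' /= fx'.
(* Flipping by the star exposes [ket x' y], which equals [ket x y] since both vectors represent
   [f]. *)
by rewrite gy /ket rip_star -/(ket x' y) -fx' fx /ket -rip_star.
Qed.

Lemma ket_ipP : right_inner_product ket_ip.
Proof.
(* Linearity in the second argument holds by computation: the operations on [E] are pointwise. *)
split=> [//|//|f g].
have [x fx] := ket_module_ket f; have [y gy] := ket_module_ket g.
by rewrite (ket_ipE fx gy) (ket_ipE gy fx) -rip_star.
Qed.

Hypothesis A_nondeg : nondegenerate_alg A.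

(** Testing [f = ket x] against the kets of [y <* a] gives [ip x y ** a = 0] for all [a], and
    non-degeneracy of [A] strips [a]. *)
Lemma ket_ip_nd : nondegenerate_ip ket_ip.
Proof.
move=> f f0; have [x fx] := ket_module_ket f.
apply/val_inj/funext => y; rewrite /= fx /ket rip_star.
suff -> : ip x y = 0 by rewrite star0.
apply: A_nondeg.1 => a; rewrite -rip_ract.
by rewrite -(ket_ipE fx (erefl : ket_of y a = _ :> (X -> A))) f0.
Qed.

Definition ket_ndip : nd_inner_product E := NdInnerProduct ket_ipP ket_ip_nd.

Lemma ket_module_nondeg (f : E) : (forall a : A, f <* a = 0) -> f = 0.
Proof.
move=> f0; apply/val_inj/funext => y; apply: A_nondeg.1 => a.
exact: (congr1 (fun g : E => g y) (f0 a)).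
Qed.

Hypothesis A_idem : idempotent_alg A.

Lemma ket_module_span :
  lspan [set g : E | exists f a, g = f <* a] = setT.
Proof.
set T := [set g : E | _]; rewrite -subTset => f _.
(* The span induction runs over bare functions, so the element of [E] above each is quantified
   existentially. *)
suff [g [/val_inj <- //]] : exists g : E, val g = f :> (X -> A) /\ lspan T g.
elim/lspan_ind: (ket_moduleE f) => [|z _ v [x [a ->]] [g [<- Tg]]].
  by exists 0; split=> //; exact: lspan0.
suff Ta : lspan T (ket_of x a).
  by exists (z *: ket_of x a + g); split=> //; exact: lspanP.
have kP z' b c : ket_of x (z' *: b + c) = z' *: ket_of x b + ket_of x c.
  by apply/val_inj; rewrite /= ractPr ketP.
move: a; apply: (spanning_ind A_idem).
- by rewrite (linear_eq0 kP); exact: lspan0.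
- by move=> z' u w ? ?; rewrite kP; exact: lspanP.
move=> _ [a [b ->]]; apply: lspan_gen; exists (ket_of x a), b.
by apply/val_inj/funext => y /=; rewrite -ractA /ket rip_ract.
Qed.

(** Since [a ** ip x y ** b = ip (x <* star a) (y <* b)], the triple products spanning [A] are inner
    products of kets in [E]. *)
Lemma ket_ip_full : full_ip ip -> full_ip ket_ip.
Proof.
move=> full; rewrite /full_ip -subTset => c _; move: c.
apply: (spanning_ind (idempotent_span3 A_idem full));
  [exact: lspan0|exact: lspanP|] => _ [a [_ [b [[x [y ->]] ->]]]].
apply: lspan_gen; exists (ket_of x (star a)), (ket_of y b).
rewrite (@ket_ipE (ket_of _ _) (ket_of _ _) (x <* star a) (y <* b)) //.
by rewrite rip_ract rip_ractl starK.
Qed.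
End RightInnerProduct.

(** * The action of [B] on kets *)

Section EquivalenceBimodule.
Variables (R : realDomainType) (A B : starAlgType R) (X : bimodType B A).
Variables (ipA : X -> X -> A) (ipB : X -> X -> B).
Hypothesis eb : equivalence_bimodule ipA ipB.
Hypothesis A_nondeg : nondegenerate_alg A.
Hypotheses (B_nondeg : nondegenerate_alg B) (B_idem : idempotent_alg B).

Local Notation ipP := (eb_ipA eb).
Local Notation E := (ket_module ipP).
Local Notation ipE := (ket_ndip ipP A_nondeg).

Lemma ipA_lactr b (x y : X) : ipA x (b *> y) = ipA (star b *> x) y.
Proof. by rewrite (eb_actB eb) starK. Qed.

Lemma ipB_lactl b (x y : X) : ipB (b *> x) y = b ** ipB x y.
Proof. by case: (eb_ipB eb). Qed.

Lemma ipB_lactr b (x y : X) : ipB x (b *> y) = ipB x y ** star b.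
Proof.
by have [_ _ sB] := eb_ipB eb; rewrite sB ipB_lactl starM -sB.
Qed.

(** By compatibility [ipB z y ** b] kills [X], so by fullness [c ** b] does for every [c]. Then
    [c ** b ** ipB x y = 0]; fullness and both halves of non-degeneracy of [B] strip the outer
    factors. *)
Lemma ipA_lact0 b : (forall x y : X, ipA y (b *> x) = 0) -> b = 0.
Proof.
move=> b0.
have cbx c (x : X) : (c ** b) *> x = 0.
  move: c; apply: (spanning_ind (eb_fullB eb)).
  - by rewrite amul0l lact0l.
  - by move=> z u v hu hv; rewrite amulPl lactPl hu hv scaler0 addr0.
  by move=> _ [z [y ->]]; rewrite -lactA -(eb_compat eb) b0 ract0r.
apply: B_nondeg.2 => c; apply: B_nondeg.1; apply: (spanning_ind (eb_fullB eb)).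
- by rewrite amul0r.
- by move=> z u v hu hv; rewrite amulPr hu hv scaler0 addr0.
move=> _ [x [y ->]]; rewrite -ipB_lactl cbx.
have [lB _ _] := eb_ipB eb.
by apply: (linear_eq0 (f := ipB^~ y)) => z u v; exact: lB.
Qed.

(** For [b = ipB p q], compatibility rewrites [b *> x] as [p <* ipA q x], which lies in [X A];
    fullness covers all [b]. *)
Lemma ket_lact_mem b (x : X) : ket ipA (b *> x) \in ket_pred ipA.
Proof.
move: b; apply: (spanning_ind (eb_fullB eb)).
- suff -> : ket ipA ((0 : B) *> x) = 0 by exact: rpred0.
  by apply/funext => y; rewrite lact0l /ket (rip0 ipP).
- by move=> z u v hu hv; rewrite lactPl (ketP ipP) rpredD ?rpredZ.
by move=> _ [p [q ->]]; rewrite -(eb_compat eb); exact: ket_of_subproof.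
Qed.

(** Precomposing with [star b] avoids choosing a representing vector; by adjunction it sends [ket x]
    to [ket (b *> x)]. *)
Fact ket_lact_subproof b (f : E) : (fun y => f (star b *> y)) \in ket_pred ipA.
Proof.
have [x ->] := ket_module_ket f.
suff -> : (fun y => ket ipA x (star b *> y)) = ket ipA (b *> x).
  exact: ket_lact_mem.
by apply/funext => y; rewrite /ket -ipA_lactr.
Qed.
Definition ket_lact b (f : E) : E := KetSpace (ket_lact_subproof b f).

Lemma ket_lactE b (f : E) (x : X) : f = ket ipA x :> (X -> A) ->
  ket_lact b f = ket ipA (b *> x) :> (X -> A).
Proof. by move=> fx; apply/funext => y; rewrite /= fx /ket -ipA_lactr. Qed.

Lemma ket_lact_Theta (f g : E) x y :
  f = ket ipA x :> (X -> A) -> g = ket ipA y :> (X -> A) ->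
  ket_lact (ipB x y) = Theta ipE f g.
Proof.
move=> fx gy; apply/funext => h; have [z hz] := ket_module_ket h.
apply/val_inj; rewrite [LHS](ket_lactE _ hz) -(eb_compat eb).
by apply/funext => u; rewrite /= (ket_ipE gy hz) fx /ket (rip_ract ipP).
Qed.

Lemma ket_lact_linear (z : cplx R) b c :
  ket_lact (z *: b + c) = z *: ket_lact b + ket_lact c.
Proof.
apply/funext => f; apply/val_inj; have [x fx] := ket_module_ket f.
by rewrite [LHS](ket_lactE _ fx) lactPl (ketP ipP) -!(ket_lactE _ fx).
Qed.

(** Since [ket x] itself may lie outside [E], [B] is spanned by [b ** ipB x y ** c = ipB (b *> x)
    (star c *> y)], whose arguments have kets in [E]. *)
Lemma ket_lact_finite_rank b : ket_lact b \in finite_rank_pred ipE.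
Proof.
move: b; apply: (spanning_ind (idempotent_span3 B_idem (eb_fullB eb))).
- by rewrite (linear_eq0 ket_lact_linear) rpred0.
- by move=> z u v hu hv; rewrite ket_lact_linear rpredD ?rpredZ.
move=> _ [b [_ [c [[x [y ->]] ->]]]]; rewrite -(starK c) -ipB_lactl -ipB_lactr.
pose k d u : E := KetSpace (ket_lact_mem d u).
rewrite (@ket_lact_Theta (k b x) (k (star c) y)) //; exact: Theta_finite_rank.
Qed.

(** * The *-isomorphism from [B] to the finite rank operators *)

Definition lact_fr b : finite_rank ipE := FiniteRank (ket_lact_finite_rank b).

Lemma lact_fr_linear (z : cplx R) b c :
  lact_fr (z *: b + c) = z *: lact_fr b + lact_fr c.
Proof. by apply/val_inj; exact: ket_lact_linear. Qed.

Lemma lact_frM b c : lact_fr (b ** c) = lact_fr b ** lact_fr c.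
Proof.
apply/val_inj/funext => f; apply/val_inj/funext => y /=.
by rewrite lactA starM.
Qed.

Lemma lact_fr_star b : lact_fr (star b) = star (lact_fr b).
Proof.
symmetry; apply: fr_star_uniq => f g /=.
have [x fx] := ket_module_ket f; have [y gy] := ket_module_ket g.
rewrite (ket_ipE (ket_lactE b fx) gy) (eb_actB eb).
by symmetry; exact: ket_ipE fx (ket_lactE _ gy).
Qed.

Lemma lact_fr_inj : injective lact_fr.
Proof.
move=> b c bc; apply/eqP; rewrite -subr_eq0; apply/eqP.
(* The factor [a] replaces [x] by [x <* a], whose ket lies in [E], where [bc] can be applied. *)
apply: ipA_lact0 => x y; apply: A_nondeg.1 => a.
rewrite -(rip_ract ipP) lractA -/(ket ipA _ y).
rewrite -(ket_lactE _ (erefl : ket_of ipP x a = ket ipA (x <* a) :> (X -> A))).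
rewrite -[b - c]addrC -scaleN1r ket_lact_linear.
have -> : ket_lact b = ket_lact c by exact: (congr1 (@fr_val _ _ _ _) bc).
by rewrite scaleN1r addNr.
Qed.

(** Every element of [E] is a ket, so [ket_lact_Theta] provides a preimage of each [Theta];
    linearity does the rest. *)
Lemma lact_fr_surj (t : finite_rank ipE) : exists b, lact_fr b = t.
Proof.
suff [b bt] : exists b, ket_lact b = t by exists b; apply/val_inj.
elim/lspan_ind: (finite_rankE t) => [|z _ v [f [g ->]] [c <-]].
  by exists 0; exact: (linear_eq0 ket_lact_linear).
have [x fx] := ket_module_ket f; have [y gy] := ket_module_ket g.
by exists (z *: ipB x y + c); rewrite ket_lact_linear (ket_lact_Theta fx gy).
Qed.

Lemma lact_fr_iso : star_isomorphism lact_fr.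
Proof.
split; [exact: lact_fr_linear|exact: lact_frM|exact: lact_fr_star|].
pose g t := sval (cid (lact_fr_surj t)).
have gK : cancel g lact_fr by move=> t; exact: svalP (cid (lact_fr_surj t)).
by exists g => // b; apply: lact_fr_inj; rewrite gK.
Qed.
End EquivalenceBimodule.

Theorem lemma3p1 (R : realDomainType) (A B : starAlgType R)
    (A_nondeg : nondegenerate_alg A) (A_idem : idempotent_alg A)
    (B_nondeg : nondegenerate_alg B) (B_idem : idempotent_alg B) :
  formally_morita_equivalent A B -> morita_star_equivalent A B.
Proof.
move=> [X [ipA [ipB eb]]].
exists (ket_module (eb_ipA eb)), (ket_ndip (eb_ipA eb) A_nondeg); split.
- exact: ket_module_span.
- exact: ket_module_nondeg.
- exact: ket_ip_full A_idem (eb_fullA eb).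
- by eexists; exact: (lact_fr_iso eb A_nondeg B_nondeg B_idem).
Qed.
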